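(* Let $q=2^m$ with $m\ge1$, and for $x=(x_1,x_2,x_3,x_4)\in\mathbb F_q^4$ put $$W(x)=(x_1,x_2,x_3,x_4,\;x_1+x_3,\;x_2+x_4)\in\mathbb F_q^6 .$$ There is a function $H:\mathbb F_q^4\to\mathbb F_q$ for which the code $\{(W(x),H(x)):x\in\mathbb F_q^4\}\subseteq\mathbb F_q^7$ corrects every adjacent burst of deletions of length zero, one, or two if and only if $q\ge16$. Moreover, there is a single function $h_*:(\mathbb F_2^4)^4\to\mathbb F_2^4$ such that for every $m\ge4$ the function $H=\widehat H_m$ obtained from $h_*$ by canonical span transport, $$\widehat H_m(x)=\theta_x^{-1}\bigl(h_*(\theta_x(x_1),\theta_x(x_2),\theta_x(x_3),\theta_x(x_4))\bigr),$$ has this correction property for $q=2^m$.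
   Context: A code of fixed length $L$ corrects every adjacent burst of length zero, one, or two if for each fixed $r\in\{0,1,2\}$ distinct codewords have disjoint sets of length-$r$ burst descendants, where a length-$r$ burst descendant of $z=z_1\cdots z_L$ is $z_1\cdots z_{d-1}z_{d+r}\cdots z_L$ for some $1\le d\le L-r+1$ (and $z$ itself if $r=0$). $\mathbb F_{2^m}$ is identified additively with $V_m=\mathbb F_2^m$ through the polynomial basis $1,\theta,\dots,\theta^{m-1}$ of $\mathbb F_2[X]/(f)$, where $f$ is the lexicographically first monic irreducible polynomial of degree $m$ and $\theta$ is the class of $X$; the binary label of $\sum_j b_j\theta^j$ is the integer $\sum_j b_j2^j$. Addition is bitwise XOR. Canonical span transport ($m\ge4$): for $x\in V_m^4$ let $\mathsf V_x=\langle x_1,x_2,x_3,x_4\rangle_{\mathbb F_2}$. Scan the elements of $\mathsf V_x$ in increasing binary-label order, retaining each element that is linearly independent of those already retained; then scan the first four standard basis vectors of $V_m$ in order, again retaining each that is independent of those already retained, until a list $\mathcal E_x$ of four independent vectors is obtained. Let $\widetilde{\mathsf V}_x=\langle\mathcal E_x\rangle$ and let $\theta_x:\widetilde{\mathsf V}_x\to\mathbb F_2^4$ be the linear isomorphism sending the ordered list $\mathcal E_x$ to the standard basis. *)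

(* Defs.v *)
From HB Require Import structures.
From mathcomp Require Import all_boot all_order all_algebra.
From mathcomp Require Import all_fingroup all_solvable all_field.

Set Implicit Arguments.
Unset Strict Implicit.
Unset Printing Implicit Defensive.

Import GRing.Theory.
Local Open Scope ring_scope.

(* The position d is 1-based; its upper bound is d <= size z - r + 1, written *)
(* without truncated subtraction. For r = 0 every d yields z itself.          *)
Definition burst_descendant (T : Type) (r : nat) (z y : seq T) : Prop :=
  exists d : nat, [/\ (1 <= d)%N, (d + r <= size z + 1)%N &
    y = take d.-1 z ++ drop (d.-1 + r) z].

Definition corrects_short_bursts (T : finType) (L : nat)
    (C : {set L.-tuple T}) : Prop :=
  forall r : nat, (r <= 2)%N ->
  forall z w : L.-tuple T, z \in C -> w \in C -> z != w ->
  forall y : seq T, ~ (burst_descendant r z y /\ burst_descendant r w y).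

Definition Wword (F : nzRingType) (x : 4.-tuple F) : 6.-tuple F :=
  [tuple x`_0; x`_1; x`_2; x`_3; x`_0 + x`_2; x`_1 + x`_3].

Definition Wcode (F : finNzRingType) (H : 4.-tuple F -> F) : {set 7.-tuple F} :=
  [set [tuple of rcons (Wword x) (H x)] | x : 4.-tuple F].

Definition binary_label (p : {poly 'F_2}) : nat :=
  (\sum_(j < size p) nat_of_ord (p`_j)%R * 2 ^ j)%N.

Definition monic_irr_deg (m : nat) (p : {poly 'F_2}) : bool :=
  [&& p \is monic, size p == m.+1 & irreducibleb p].

(* On polynomials of a common degree, the order of binary labels is the       *)
(* lexicographic order of coefficient sequences, leading coefficient first.   *)
(* The default value 0 is not reached when m > 0, see first_irrP.             *)
Definition first_irr (m : nat) : {poly 'F_2} :=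
  [arg min_(p < (0%R : {poly_(m.+1) 'F_2}) | monic_irr_deg m p) binary_label p]%N.

Lemma monic_irr_deg_exists (m : nat) :
  (0 < m)%N -> exists p : {poly_(m.+1) 'F_2}, monic_irr_deg m p.
Proof.
move=> m_gt0; have [L charL cardL] := pPrimePowerField (isT : prime 2) m_gt0.
pose K : splittingFieldType 'F_2 := pPrimeCharType charL.
have dimK : \dim {:K} = m.
  by rewrite (pprimeChar_dimf charL) cardL pfactorK.
have [z Kz] : exists z : K, {:K}%VS = <<1; z>>%VS.
  exists (separable_generator 1 {:K}).
  apply: eq_adjoin_separable_generator; last exact: sub1v.
  by have /and3P[] := finField_galois (sub1v {:K}%AS).
have /polyOver1P[q Dq] := minPolyOver 1%AS z.
have szq : size q = m.+1.
  have := size_minPoly 1 z; rewrite Dq size_map_poly => ->.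
  by rewrite adjoin_degreeE -Kz dimv1 divn1 dimK.
have szq1 : (size q <= m.+1)%N by rewrite szq.
exists (NPoly szq1); rewrite /monic_irr_deg /= szq eqxx /=; apply/andP; split.
  by rewrite -(map_monic (in_alg K)) -Dq monic_minPoly.
apply/irreducibleP; split=> [|p szp dvd_pq]; first by rewrite szq ltnS.
have /minPoly_irr : map_poly (in_alg K) p \is a polyOver 1%VS.
  by apply/polyOver1P; exists p.
move=> /(_ z); rewrite Dq dvdp_map => /(_ dvd_pq) /orP[].
  by rewrite eqp_map.
by rewrite -size_poly_eq1 size_map_poly (negPf szp).
Qed.

Lemma first_irrP (m : nat) : (0 < m)%N ->
  monic_irr_deg m (first_irr m) /\
  forall p : {poly 'F_2}, monic_irr_deg m p ->
    (binary_label (first_irr m) <= binary_label p)%N.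
Proof.
move=> m_gt0; have [p0 p0P] := monic_irr_deg_exists m_gt0.
rewrite /first_irr /arg_min /extremum; case: pickP => [p /andP[pP /forallP pmin]|].
  split=> // q qP; have szq : (size q <= m.+1)%N by case/and3P: qP => _ /eqP->.
  by have /implyP := pmin (NPoly szq); apply.
have [p pP pmin] := @arg_minnP _ p0 (fun p : {poly_(m.+1) 'F_2} => monic_irr_deg m p)
  (fun p => binary_label p) p0P.
move=> /(_ p) /negP[]; apply/andP; split=> //; apply/forallP=> q.
by apply/implyP=> /pmin.
Qed.

Lemma first_irr_mi (m : nat) :
  (0 < m)%N -> monic_irreducible_poly (first_irr m).
Proof. by move=> /first_irrP[/and3P[? _ /irreducibleP ?] _]; split. Qed.

(* The carrier consists of the polynomials of size at most m over 'F_2, so    *)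
(* coefficient sequences are coordinates in the basis 1, theta, ...           *)
Definition GF2m (m : nat) (m_gt0 : (0 < m)%N) :=
  {poly %/ first_irr m with first_irr_mi m_gt0}.

HB.instance Definition _ m m_gt0 := GRing.Field.on (@GF2m m m_gt0).
HB.instance Definition _ m m_gt0 := Finite.on (@GF2m m m_gt0).
HB.instance Definition _ m m_gt0 := Vector.on (@GF2m m m_gt0).


Definition elt_label (m : nat) (m_gt0 : (0 < m)%N) (v : GF2m m_gt0) : nat :=
  binary_label (val v).

Definition scan_by_label (m : nat) (m_gt0 : (0 < m)%N) : seq (GF2m m_gt0) :=
  sort (fun u v => elt_label u <= elt_label v)%N (enum (GF2m m_gt0)).

Definition retain (m : nat) (m_gt0 : (0 < m)%N)
    (s : seq (GF2m m_gt0)) (v : GF2m m_gt0) : seq (GF2m m_gt0) :=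
  if (size s < 4)%N && (v \notin <<s>>%VS) then rcons s v else s.

Definition transport_list (m : nat) (m_gt0 : (0 < m)%N)
    (x : 4.-tuple (GF2m m_gt0)) : seq (GF2m m_gt0) :=
  foldl (@retain m m_gt0) [::]
    ([seq v <- scan_by_label m_gt0 | v \in <<x>>%VS] ++
     [seq 'qX ^+ j | j <- iota 0 4]).

(* For 4 <= m the list has exactly four entries, see transport_list_free; the *)
(* conversion to a tuple is then the identity.                                *)
Definition transport_basis (m : nat) (m_gt0 : (0 < m)%N)
    (x : 4.-tuple (GF2m m_gt0)) : 4.-tuple (GF2m m_gt0) :=
  [tuple (transport_list x)`_i | i < 4].

Definition theta (m : nat) (m_gt0 : (0 < m)%N)
    (x : 4.-tuple (GF2m m_gt0)) (v : GF2m m_gt0) : 'rV['F_2]_4 :=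
  \row_(i < 4) coord (transport_basis x) i v.

Definition theta_inv (m : nat) (m_gt0 : (0 < m)%N)
    (x : 4.-tuple (GF2m m_gt0)) (c : 'rV['F_2]_4) : GF2m m_gt0 :=
  \sum_(i < 4) c 0 i *: (transport_basis x)`_i.

Definition span_transport (h : 4.-tuple 'rV['F_2]_4 -> 'rV['F_2]_4)
    (m : nat) (m_gt0 : (0 < m)%N) (x : 4.-tuple (GF2m m_gt0)) : GF2m m_gt0 :=
  theta_inv x (h [tuple of map (theta x) x]).

Lemma card_GF2m (m : nat) (m_gt0 : (0 < m)%N) : #|GF2m m_gt0| = (2 ^ m)%N.
Proof.
have [/and3P[_ /eqP szf _] _] := first_irrP m_gt0.
by rewrite card_qfpoly card_Fp // szf.
Qed.

Lemma free_powers (m : nat) (m_gt0 : (0 < m)%N) : (4 <= m)%N ->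
  free [seq ('qX : GF2m m_gt0) ^+ j | j <- iota 0 4].
Proof.
move=> m_ge4; have [/and3P[_ /eqP szf _] _] := first_irrP m_gt0.
have fmi := first_irr_mi m_gt0.
have valX j : (j < 4)%N -> val (('qX : GF2m m_gt0) ^+ j) = 'X^j.
  move=> j_lt4; rewrite [LHS]poly_of_qpolyX qpolyXE ?fmi ?szf //; last first.
    by rewrite ltnS (leq_trans _ m_ge4).
  rewrite Pdiv.CommonRing.rmodp_small // mk_monicE //.
  by rewrite size_polyXn szf ltnS (leq_trans j_lt4).
pose X := [tuple ('qX : GF2m m_gt0) ^+ j | j < 4].
have -> : [seq ('qX : GF2m m_gt0) ^+ j | j <- iota 0 4] = X.
  by rewrite -[in LHS]val_enum_ord -map_comp.
apply/freeP=> k sumk0 i.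
have: val (\sum_(i < 4) k i *: X`_i) = \sum_(i < 4) k i *: 'X^i.
  rewrite (big_morph val (id1 := 0) (op1 := +%R)) //.
  apply: eq_bigr => j _; rewrite -tnth_nth tnth_mktuple.
  by rewrite -(valX j).
rewrite sumk0 => /(congr1 (fun p : {poly 'F_2} => p`_i)).
rewrite coef0 coef_sum (bigD1 i) //= coefZ coefXn eqxx mulr1 big1 ?addr0 //.
by move=> j ji; rewrite coefZ coefXn eq_sym (negPf (ji : _ != _ :> nat)) mulr0.
Qed.

Lemma foldl_retain (m : nat) (m_gt0 : (0 < m)%N) (l s : seq (GF2m m_gt0)) :
  free s -> (size s <= 4)%N ->
  let r := foldl (@retain m m_gt0) s l in
  [/\ free r, (size r <= 4)%N, (<<s>> <= <<r>>)%VS,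
      {subset r <= s ++ l} & size r = 4%N \/ {subset l <= <<r>>%VS}].
Proof.
elim: l s => [|v l IHl] s frs szs /=.
  by split=> //; [move=> u; rewrite cats0 | right].
have [frs' szs'] : free (retain s v) /\ (size (retain s v) <= 4)%N.
  rewrite /retain; case: ifP => // /andP[szs4 vNs].
  rewrite size_rcons; split=> //.
  have /perm_free-> : perm_eq (rcons s v) (v :: s) by rewrite perm_rcons.
  by rewrite free_cons vNs.
have [fr szr sr subr spr] := IHl _ frs' szs'.
have ss' : (<<s>> <= <<retain s v>>)%VS.
  rewrite /retain; case: ifP => // _.
  by rewrite -cats1 span_cat addvSl.
split=> //; first exact: subv_trans sr.
  move=> u /subr; rewrite !mem_cat inE => /orP[|->]; last by rewrite !orbT.
  rewrite /retain; case: ifP => [_|_ ->//].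
  by rewrite mem_rcons inE => /orP[->|->]; rewrite ?orbT.
have [|szr4] := eqVneq (size (foldl (@retain m m_gt0) (retain s v) l)) 4%N.
  by left.
have szr_lt4 : (size (foldl (@retain m m_gt0) (retain s v) l) < 4)%N.
  by rewrite ltn_neqAle szr4.
case: spr => [/eqP|lr]; first by rewrite (negPf szr4).
right=> u; rewrite inE => /orP[/eqP->|/lr//].
apply: (subvP sr); rewrite /retain.
case: ifP => [_|/negbT]; first by rewrite memv_span // mem_rcons mem_head.
rewrite negb_and negbK => /orP[|//].
have : (size s <= size (foldl (@retain m m_gt0) (retain s v) l))%N.
  have /eqP <- := frs; have /eqP <- := fr.
  by apply/dimvS/(subv_trans ss').
by move=> /leq_ltn_trans/(_ szr_lt4) ->.
Qed.

Lemma transport_list_free (m : nat) (m_gt0 : (0 < m)%N)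
    (x : 4.-tuple (GF2m m_gt0)) : (4 <= m)%N ->
  [/\ size (transport_list x) = 4%N, free (transport_list x) &
      (<<x>> <= <<transport_list x>>)%VS].
Proof.
move=> m_ge4; rewrite /transport_list foldl_cat.
set l1 := [seq v <- _ | _]; set r1 := foldl _ _ l1.
have [fr1 szr1 _ r1l spr1] := @foldl_retain m m_gt0 l1 [::] (nil_free _) isT.
rewrite -/r1 in fr1 szr1 r1l spr1.
have [fr2 szr2 sr2 _ spr2] :=
  @foldl_retain m m_gt0 [seq 'qX ^+ j | j <- iota 0 4] r1 fr1 szr1.
have r1V : (<<r1>> <= <<x>>)%VS.
  by apply/span_subvP=> v /r1l; rewrite mem_filter => /andP[].
split=> //; last first.
  apply: subv_trans sr2; case: spr1 => [szr14|l1r].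
    suff /eqP-> : <<r1>>%VS == <<x>>%VS by [].
    rewrite eqEdim r1V /=; have /eqP -> := fr1.
    by rewrite szr14; have := dim_span x; rewrite size_tuple.
  apply/subvP=> v vx; apply: l1r.
  by rewrite mem_filter vx mem_sort mem_enum.
case: spr2 => // /span_subvP/dimvS.
have /eqP -> := free_powers m_gt0 m_ge4; have /eqP -> := fr2.
by move=> sz4; apply/eqP; rewrite eqn_leq szr2.
Qed.

Lemma transport_basisE (m : nat) (m_gt0 : (0 < m)%N)
    (x : 4.-tuple (GF2m m_gt0)) : (4 <= m)%N ->
  transport_basis x = transport_list x :> seq (GF2m m_gt0).
Proof.
move=> m_ge4; have [sz4 _ _] := transport_list_free x m_ge4.
apply: (@eq_from_nth _ 0) => [|i]; first by rewrite size_tuple sz4.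
rewrite size_tuple => i4.
by rewrite -[i]/(nat_of_ord (Ordinal i4)) -tnth_nth tnth_mktuple.
Qed.

Lemma thetaK (m : nat) (m_gt0 : (0 < m)%N) (x : 4.-tuple (GF2m m_gt0)) :
  (4 <= m)%N -> {in <<transport_list x>>%VS, cancel (theta x) (theta_inv x)}.
Proof.
move=> m_ge4 v; rewrite -(transport_basisE x m_ge4) => vE.
by rewrite /theta_inv [RHS](coord_span vE); apply: eq_bigr => i _; rewrite mxE.
Qed.

Lemma theta_invK (m : nat) (m_gt0 : (0 < m)%N) (x : 4.-tuple (GF2m m_gt0)) :
  (4 <= m)%N -> cancel (theta_inv x) (theta x).
Proof.
move=> m_ge4 c; have [_ fr _] := transport_list_free x m_ge4.
rewrite -(transport_basisE x m_ge4) in fr.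
by apply/rowP=> i; rewrite mxE /theta_inv coord_sum_free.
Qed.

(* Main.v *)
(** The word (x1, x2, x3, x4, x1 + x3, x2 + x4) interleaves two zero-sum triples,
    and an adjacent burst of length at most two erases at most one entry of each.
    So every descendant of a codeword determines the span of x: two codewords
    with a common descendant have the same transport isomorphism, which reduces
    the problem over GF(2^m) to F_2^4. There h_* x is a combination of the frame
    of x, made of the entries of x outside the span of the previous ones and of a
    basis of a complement of the span of x. The combination depends only on the
    linear relations of x, with one exception forced by symmetry in dimension
    three: when both triples span planes, meeting in a line generated by a, it
    also depends on the values on x of a linear form psi with psi a = 1, chosen as
    a function of a. Everything is then expressed in the coordinates of the frame,
    and finitely many cases remain, which are checked by computation.

    Conversely, the word (0, 0, 1, 0) forces b := H (0, 0, 1, 0) to differ from 0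
    and 1, and there are six vectors over the plane spanned by 1 and b that are
    pairwise in conflict and whose values under H all avoid 1, b and 1 + b. This makes
    nine distinct elements of the field. *)

Require Import Defs.
From Stdlib Require Import BinNat.
From mathcomp Require Import all_boot all_order all_algebra.
From mathcomp Require Import all_fingroup all_solvable all_field.

Set Implicit Arguments.
Unset Strict Implicit.
Unset Printing Implicit Defensive.

Import GRing.Theory.
Local Open Scope ring_scope.

(** * Deletions, coefficient masks and the colouring scheme *)

Definition del (T : Type) (i r : nat) (s : seq T) : seq T :=
  take i s ++ drop (i + r) s.

Lemma map_del (T U : Type) (f : T -> U) (i r : nat) (s : seq T) :
  map f (del i r s) = del i r (map f s).
Proof. by rewrite map_cat map_take map_drop. Qed.

Fixpoint choices (T : Type) (ls : seq (seq T)) : seq (seq T) :=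
  if ls is l :: ls' then [seq a :: s | a <- l, s <- choices ls'] else [:: [::]].

Lemma mem_choices (T : eqType) (ls : seq (seq T)) (s : seq T) :
  all2 (fun a l => a \in l) s ls -> s \in choices ls.
Proof.
elim: ls s => [|l ls IHls] [|a s] //= /andP[al /IHls sls].
by apply/allpairsP; exists (a, s).
Qed.

(** The numbers below [2 ^ k] in increasing order, read as coefficient vectors over F_2, the lowest
    bit belonging to the first vector. *)
Fixpoint masks (k : nat) : seq N :=
  if k is k'.+1 then flatten [seq [:: N.double c; N.succ_double c] | c <- masks k']
  else [:: 0%num].

Definition unit_mask (i : nat) : N := iter i N.double 1%num.

Definition nibbles : seq N := masks 4.
Definition units : seq N := [seq unit_mask i | i <- iota 0 4].

Lemma masksP (k : nat) (c : N) :
  reflect (exists2 e, e \in masks k & c = N.double e \/ c = N.succ_double e)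
          (c \in masks k.+1).
Proof.
apply: (iffP flatten_mapP) => -[e e_k].
  by rewrite !inE => /orP[] /eqP->; exists e; auto.
by case=> ->; exists e; rewrite // !inE eqxx ?orbT.
Qed.

(* Instantiated both to [N] with bitwise XOR, for the exhaustive check, and to *)
(* the vector spaces this check is transferred to.                            *)
Section Scheme.
Variables (V : eqType) (z : V) (add : V -> V -> V).
Implicit Types (x y s ext u : seq V) (c : N).

Definition word x (h : V) : seq V :=
  [:: nth z x 0; nth z x 1; nth z x 2; nth z x 3;
      add (nth z x 0) (nth z x 2); add (nth z x 1) (nth z x 3); h].

(* A burst of length at most two hits each of the zero-sum triples at         *)
(* positions {0, 2, 4} and {1, 3, 5} at most once.                            *)
Definition decode (r j : nat) u : seq V :=
  let k := minn j (6 - r) in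
  let w := take k (take (6 - r) u) ++ nseq r z ++ drop k (take (6 - r) u) in
  [seq if (k <= i < k + r)%N
       then add (nth z w ((i + 2) %% 6)) (nth z w ((i + 4) %% 6))
       else nth z w i | i <- iota 0 4].

Fixpoint comb s c : V :=
  if s is v :: s' then
    if N.odd c then add v (comb s' (N.div2 c)) else comb s' (N.div2 c)
  else z.

(* The first mask expressing [v] through [s], or [unit_mask (size s)] if there is *)
(* none.                                                                       *)
Definition digit s (v : V) : N :=
  nth (unit_mask (size s)) (masks (size s))
      (find (fun c => comb s c == v) (masks (size s))).

(** These record the linear relations of [x] and are unchanged by injective additive maps. *)
Definition digits x : seq N := [seq digit (take i x) (nth z x i) | i <- iota 0 4].

Definition pivots x : bitseq :=
  [seq nth 0%num (digits x) i == unit_mask i | i <- iota 0 4].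

(** A new entry keeps its own index, so that [unit_mask i] becomes its coordinate vector; [ext]
    fills the other places. *)
Fixpoint frame (ps : bitseq) x ext : seq V :=
  if ps is b :: ps' then
    if b then head z x :: frame ps' (behead x) ext
    else head z ext :: frame ps' (behead x) (behead ext)
  else [::].

(** Over F_2 a zero-sum triple has distinct entries exactly when it spans a plane, and two such
    planes meet in a line exactly when the triples share a single entry. All other cases give
    [z]. *)
Definition axis x : V :=
  let A := [:: nth z x 0; nth z x 2; add (nth z x 0) (nth z x 2)] in
  let B := [:: nth z x 1; nth z x 3; add (nth z x 1) (nth z x 3)] in
  if uniq A && uniq B then
    if [seq v <- A | v \in B] is [:: a] then a else z
  else z.

End Scheme.

(* Each entry is a colour with the keys it is given to; all other keys have   *)
(* colour 12. A key lists, in hexadecimal, the four digits of x and the mask  *)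
(* of the indices i with psi x_i. Found by computer search.                   *)
Definition palette : seq (N * seq N) :=
  [:: (0, [:: 0x10180; 0x1241d]);
      (2, [:: 0x12110; 0x1244f]);
      (3, [:: 0x11100; 0x12130; 0x12437]);
      (4, [:: 0x12386]);
      (5, [:: 0x02200; 0x12210]);
      (6, [:: 0x12476]);
      (7, [:: 0x11450; 0x12000; 0x12030; 0x12320; 0x1245c]);
      (8, [:: 0x02080; 0x11483; 0x12180; 0x12466; 0x12473]);
      (9, [:: 0x00480; 0x02220; 0x12120; 0x1238e]);
      (10, [:: 0x10100; 0x11000; 0x11080; 0x1228f]);
      (11, [:: 0x00400; 0x02460; 0x12330; 0x1241b; 0x1244c; 0x12479]);
      (13, [:: 0x02420; 0x12310; 0x12383]);
      (14, [:: 0x02000; 0x11110; 0x12220; 0x12420; 0x1246d]);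
      (15, [:: 0x02280; 0x10110; 0x11400; 0x1148b; 0x12100; 0x12230; 0x12300;
               0x12439])]%num.

Definition key (d : seq N) (bs : bitseq) : N :=
  foldl (fun n e => N.add (N.mul 16 n) e) 0%num
    (rcons d (foldr (fun (b : bool) n => if b then N.succ_double n else N.double n)
                    0%num bs)).

Definition colour (k : N) : N :=
  (nth (12%num, [::]) palette (find (fun e => k \in e.2) palette)).1.

Definition hue (V : eqType) (z : V) (add : V -> V -> V) (x ext : seq V)
    (psi : V -> bool) : V :=
  comb z add (frame z (pivots z add x) x ext)
    (colour (key (digits z add x) (map psi x))).

(** * Exhaustive check in coordinates *)

Local Notation wordN := (word 0%num N.lxor).
Local Notation decodeN := (decode 0%num N.lxor).
Local Notation combN := (comb 0%num N.lxor).
Local Notation digitsN := (digits 0%num N.lxor).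
Local Notation pivotsN := (pivots 0%num N.lxor).
Local Notation axisN := (axis 0%num N.lxor).
Local Notation hueN := (hue 0%num N.lxor).
Local Notation parity := (comb false addb).

(** The candidate model for a list of digits: a mask combines earlier entries, and the marker of a
    new entry introduces a unit vector. *)
Definition rebuild (d : seq N) : seq N :=
  foldl (fun s e => rcons s (combN (rcons s (unit_mask (size s))) e)) [::] d.

Definition cobasis (x : seq N) : seq N := mask (map negb (pivotsN x)) units.

(* Nested conditionals, since vm_compute evaluates both arguments of [&&].    *)
Definition separated (x : seq N) (p : bitseq) (r i j : nat) : bool :=
  let u := del i r (wordN x (hueN x (cobasis x) (parity p))) in
  let y := decodeN r j u in
  if y == x then true else
  if take (6 - r) (del j r (wordN y 0%num)) == take (6 - r) u then
    if axisN y == axisN x then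
      del j r (wordN y (hueN y (cobasis x) (parity p))) != u
    else false
  else true.

(* [p] lists the values on the frame of a linear form equal to 1 at the axis, *)
(* and is zero if there is no axis.                                           *)
Definition admissible (x : seq N) (p : bitseq) : bool :=
  if axisN x == 0%num then p == nseq 4 false else parity p (axisN x).

(** Lists that [rebuild] does not reproduce are skipped: by [digits_rebuild] they are the digits of
    no four vectors in dimension four. Length zero is absent because an intact word shows [x]. *)
Definition all_separated : bool :=
  all (fun d => let x := rebuild d in
    if digitsN x == d then
      all (fun p =>
        if admissible x p then
          all (fun r =>
            all (fun i => all (separated x p r i) (iota 0 (8 - r))) (iota 0 (8 - r)))
            [:: 1; 2]
        else true) (choices (nseq 4 [:: false; true]))
    else true)
  (choices [seq rcons (masks i) (unit_mask i) | i <- iota 0 4]).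

Lemma all_separatedE : all_separated.
Proof. by vm_compute. Qed.

(* Otherwise closing tactics may unfold the palette. *)
Opaque colour.

(** * Transfer along additive maps *)

Section Transfer.
Variables (V1 V2 : eqType) (z1 : V1) (z2 : V2).
Variables (add1 : V1 -> V1 -> V1) (add2 : V2 -> V2 -> V2) (f : V1 -> V2).
Hypothesis f0 : f z1 = z2.
Hypothesis fD : {morph f : u v / add1 u v >-> add2 u v}.

Lemma nth_transfer (x : seq V1) (i : nat) : nth z2 (map f x) i = f (nth z1 x i).
Proof. by elim: x i => [|v x IHx] [|i] /=. Qed.

Lemma word_transfer (x : seq V1) (h : V1) :
  map f (word z1 add1 x h) = word z2 add2 (map f x) (f h).
Proof. by rewrite /word !nth_transfer /= !fD. Qed.

Lemma decode_transfer (r j : nat) (u : seq V1) :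
  map f (decode z1 add1 r j u) = decode z2 add2 r j (map f u).
Proof.
rewrite /decode -map_comp; apply: eq_map => i /=.
rewrite -!map_take -map_drop -f0 -map_nseq -!map_cat f0 !nth_transfer.
by case: ifP => // _; rewrite fD.
Qed.

Lemma comb_transfer (s : seq V1) (c : N) :
  f (comb z1 add1 s c) = comb z2 add2 (map f s) c.
Proof. by elim: s c => //= v s IHs c; case: ifP => _; rewrite ?fD IHs. Qed.

Lemma frame_transfer (ps : bitseq) (x ext : seq V1) :
  map f (frame z1 ps x ext) = frame z2 ps (map f x) (map f ext).
Proof.
elim: ps x ext => //= b ps IHps x ext.
by case: b => /=; rewrite IHps !behead_map -!nth0 !nth_transfer.
Qed.

(** Injectivity is asked only on a set closed under addition, such as the masks of bounded length
    inside [N]. *)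
Variable P : pred V1.
Hypotheses (P0 : P z1) (PD : forall u v, P u -> P v -> P (add1 u v)).
Hypothesis f_inj : {in P &, injective f}.

Lemma nth_closed (x : seq V1) (i : nat) : all P x -> P (nth z1 x i).
Proof. by elim: x i => [|v x IHx] [|i] //= /andP[Pv /IHx]. Qed.

Lemma comb_closed (s : seq V1) (c : N) : all P s -> P (comb z1 add1 s c).
Proof.
by elim: s c => //= v s IHs c /andP[Pv /IHs Ps]; case: ifP => _; rewrite ?PD.
Qed.

Lemma eq_transfer (u v : V1) : P u -> P v -> (f u == f v) = (u == v).
Proof. exact: (inj_in_eq f_inj). Qed.

Lemma digit_transfer (s : seq V1) (v : V1) : all P s -> P v ->
  digit z2 add2 (map f s) (f v) = digit z1 add1 s v.
Proof.
move=> Ps Pv; rewrite /digit size_map; congr nth; apply: eq_find => c.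
by rewrite -comb_transfer eq_transfer ?comb_closed.
Qed.

Lemma digits_transfer (x : seq V1) : all P x ->
  digits z2 add2 (map f x) = digits z1 add1 x.
Proof.
move=> Px; apply: eq_map => i; rewrite -map_take nth_transfer digit_transfer //.
  by apply/allP => v /mem_take; apply: (allP Px).
exact: nth_closed.
Qed.

Lemma axis_transfer (x : seq V1) : all P x ->
  axis z2 add2 (map f x) = f (axis z1 add1 x).
Proof.
move=> Px; have Pn i : P (nth z1 x i) by apply: nth_closed.
rewrite /axis !nth_transfer -!fD.
set A := [:: nth z1 x 0; _; _]; set B := [:: nth z1 x 1; _; _].
have PA : {in A, forall u, P u} by apply/allP; rewrite /= !Pn PD.
have PB : {in B, forall u, P u} by apply/allP; rewrite /= !Pn PD.
rewrite -[[:: f (nth z1 x 0); _; _]]/(map f A) -[[:: f (nth z1 x 1); _; _]]/(map f B).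
have injA : {in A &, injective f} by apply: sub_in2 f_inj.
have injB : {in B &, injective f} by apply: sub_in2 f_inj.
rewrite !map_inj_in_uniq //; case: ifP => _; last by rewrite f0.
have -> : [seq v <- map f A | v \in map f B] = map f [seq v <- A | v \in B].
  rewrite filter_map; congr map; apply: eq_in_filter => u uA.
  apply/mapP/idP => [[v vB fuv]|uB]; last by exists u.
  by rewrite (f_inj (PA _ uA) (PB _ vB) fuv).
by case: [seq v <- A | _] => [|a [|? ?]]; rewrite ?f0.
Qed.

Lemma axis_closed (x : seq V1) : all P x -> P (axis z1 add1 x).
Proof.
move=> Px; rewrite /axis; set A := [:: _; _; _]; set B := [:: _; _; _].
have /allP PA : all P A by rewrite /= !PD ?nth_closed.
case: ifP => // _; case E: [seq v <- A | _] => [|a [|? ?]] //.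
by apply: PA; apply: (mem_subseq (filter_subseq (mem B) A)); rewrite E mem_head.
Qed.

Lemma frame_closed (ps : bitseq) (x ext : seq V1) :
  all P x -> all P ext -> all P (frame z1 ps x ext).
Proof.
elim: ps x ext => //= b ps IHps x ext Px Pe.
have Pb (s : seq V1) : all P s -> P (head z1 s) && all P (behead s).
  by case: s => [|v s] //=; rewrite P0.
have [Phx Pbx] := andP (Pb _ Px); have [Phe Pbe] := andP (Pb _ Pe).
by case: b => /=; rewrite ?Phx ?Phe IHps.
Qed.

Lemma hue_closed (x ext : seq V1) (psi : V1 -> bool) :
  all P x -> all P ext -> P (hue z1 add1 x ext psi).
Proof. by move=> Px Pe; apply/comb_closed/frame_closed. Qed.

Lemma all_del (i r : nat) (u : seq V1) : all P u -> all P (del i r u).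
Proof.
move=> /allP Pu; apply/allP => v; rewrite mem_cat.
by case/orP => [/mem_take|/mem_drop] /Pu.
Qed.

Lemma word_closed (x : seq V1) (h : V1) : all P x -> P h -> all P (word z1 add1 x h).
Proof. by move=> Px Ph; rewrite /= !nth_closed ?Ph // !PD ?nth_closed. Qed.

Lemma decode_closed (r j : nat) (u : seq V1) :
  all P u -> all P (decode z1 add1 r j u).
Proof.
move=> /allP Pu; apply/allP => v /mapP[i _ ->].
set w := take _ _ ++ _; have Pw : all P w.
  apply/allP => t; rewrite !mem_cat.
  by case/or3P => [/mem_take/mem_take/Pu|/nseqP[->]|/mem_drop/mem_take/Pu].
by case: ifP => _; rewrite ?PD ?nth_closed.
Qed.

Lemma map_transfer_inj (s t : seq V1) : all P s -> all P t ->
  map f s = map f t -> s = t.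
Proof.
elim: s t => [|v s IHs] [|w t] //= /andP[Pv Ps] /andP[Pw Pt] [fvw /(IHs _ Ps Pt) ->].
by rewrite (f_inj Pv Pw fvw).
Qed.

(** Equal digits give equal pivots and, with matching forms, equal colours; combinations of a frame
    commute with [f]. *)
Lemma hue_transfer (x ext : seq V1) (psi1 : V1 -> bool) (psi2 : V2 -> bool) :
  all P x -> psi2 \o f =1 psi1 ->
  hue z2 add2 (map f x) (map f ext) psi2 = f (hue z1 add1 x ext psi1).
Proof.
move=> Px psiE; have dE := digits_transfer Px.
have pE : pivots z2 add2 (map f x) = pivots z1 add1 x by rewrite /pivots dE.
by rewrite /hue dE pE -map_comp (eq_map psiE) -frame_transfer -comb_transfer.
Qed.

End Transfer.

(** * Decoding a descendant *)

Lemma word_inj (V : eqType) (z : V) (add : V -> V -> V) (x y : seq V) (h k : V) :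
  size x = 4%N -> size y = 4%N -> word z add x h = word z add y k -> x = y.
Proof.
case: x => [|? [|? [|? [|? []]]]] // _; case: y => [|? [|? [|? [|? []]]]] // _.
by case=> -> -> -> ->.
Qed.

(** At most [r] of the first six symbols are lost, so the last symbol lies beyond this prefix. *)
Lemma take_del_word (V : eqType) (z : V) (add : V -> V -> V) (r j : nat)
    (x : seq V) (h k : V) : (r <= 2)%N -> (j + r <= 7)%N ->
  take (6 - r) (del j r (word z add x h)) = take (6 - r) (del j r (word z add x k)).
Proof.
case: r => [|[|[|r]]] r_le; last by case: (notF r_le).
all: case: j => [|[|[|[|[|[|[|[|j]]]]]]]] j_le.
all: try by case: (notF j_le).
all: reflexivity.
Qed.

(** An erased symbol is the sum of the two others in its triple. A burst reaching the last symbol is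
    treated as ending just before it, which at worst ignores one surviving symbol. *)
Lemma decodeK (V : eqType) (z : V) (add : V -> V -> V) (r j : nat)
    (x : seq V) (h : V) :
    size x = 4%N -> (r <= 2)%N -> (j + r <= 7)%N ->
    (forall v w, add v (add v w) = w) -> (forall v w, add v (add w v) = w) ->
    (forall v w, add (add v w) v = w) ->
  decode z add r j (del j r (word z add x h)) = x.
Proof.
case: x => [|x0 [|x1 [|x2 [|x3 [|x4 x]]]]] sz; try by discriminate sz.
case: r => [|[|[|r]]] r_le; last by case: (notF r_le).
all: case: j => [|[|[|[|[|[|[|[|j]]]]]]]] j_le.
all: try by case: (notF j_le).
all: move=> addK1 addK2 addK3; lazy; rewrite ?addK1 ?addK2 ?addK3.
all: reflexivity.
Qed.
(** * Combinations over the field with two elements *)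

Lemma mem_take_del (T : eqType) (k r j : nat) (s : seq T) : (j <= size s)%N ->
  {subset take k (del j r s) <= take (k + r) s}.
Proof.
move=> js v; rewrite /del take_cat size_takel //; case: ltnP => [kj|jk].
  rewrite take_takel ?(ltnW kj) // => v_k.
  by apply: (mem_take (n0 := k)); rewrite take_takel ?leq_addr.
rewrite take_drop mem_cat => /orP[v_j|/mem_drop]; last first.
  by rewrite addnA subnK.
by apply: (mem_take (n0 := j)); rewrite take_takel ?(leq_trans jk) ?leq_addr.
Qed.

Lemma N_div2_double (c : N) : N.div2 (N.double c) = c.
Proof. by case: c. Qed.

Lemma N_div2_succ_double (c : N) : N.div2 (N.succ_double c) = c.
Proof. by case: c. Qed.

Lemma N_odd_double (c : N) : N.odd (N.double c) = false.
Proof. by case: c. Qed.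

Lemma N_odd_succ_double (c : N) : N.odd (N.succ_double c).
Proof. by case: c. Qed.

Lemma masks_lxor (k : nat) (c e : N) :
  c \in masks k -> e \in masks k -> N.lxor c e \in masks k.
Proof.
elim: k c e => [|k IHk] c e; first by rewrite !inE => /eqP-> /eqP->.
have half n : n \in masks k.+1 -> N.div2 n \in masks k.
  by case/masksP => a a_k [] ->; rewrite ?N_div2_double ?N_div2_succ_double.
move=> /half c_k /half e_k; apply/masksP; exists (N.div2 (N.lxor c e)).
  by rewrite !N.div2_spec N.shiftr_lxor -!N.div2_spec IHk.
by case: (N.lxor c e) => [|[a|a|]]; [left | right | left | right].
Qed.

Section F2Vectors.
Variable V : vectType 'F_2.
Implicit Types (x s ext : seq V) (v w h : V) (c e : N).

Local Notation wordV := (word (0 : V) +%R).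
Local Notation decodeV := (decode (0 : V) +%R).
Local Notation combV := (comb (0 : V) +%R).
Local Notation digitV := (digit (0 : V) +%R).
Local Notation pivotsV := (pivots (0 : V) +%R).

Lemma addvv_F2 v : v + v = 0.
Proof. by rewrite -mulr2n -scaler_nat (_ : 2%:R = 0) ?scale0r //; apply/eqP. Qed.

Lemma decode_wordK (r j : nat) x h : size x = 4%N -> (r <= 2)%N -> (j + r <= 7)%N ->
  decodeV r j (del j r (wordV x h)) = x.
Proof.
move=> szx r2 jr; apply: decodeK => // v w.
- by rewrite addrA addvv_F2 add0r.
- by rewrite addrCA addvv_F2 addr0.
- by rewrite addrAC addvv_F2 add0r.
Qed.

Lemma decode_span (r j : nat) s : {subset decodeV r j s <= <<take (6 - r) s>>%VS}.
Proof.
move=> v /mapP[i _ ->]; set u := take (6 - r) s.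
have nth_u k : nth 0 (take (minn j (6 - r)) u ++ nseq r 0 ++ drop (minn j (6 - r)) u) k
    \in <<u>>%VS.
  set w := _ ++ _; have [k_ge|/(mem_nth 0)] := leqP (size w) k.
    by rewrite nth_default ?mem0v.
  rewrite !mem_cat => /or3P[/mem_take/memv_span //|/nseqP[-> _]|/mem_drop/memv_span //].
  exact: mem0v.
by case: ifP => _; rewrite ?memvD.
Qed.

Lemma word_span x h : size x = 4%N -> {subset take 6 (wordV x h) <= <<x>>%VS}.
Proof.
case: x => [|x0 [|x1 [|x2 [|x3 []]]]] // _ v.
rewrite /word /= !inE.
have X0 : x0 \in <<[:: x0; x1; x2; x3]>>%VS by rewrite memv_span ?inE ?eqxx.
have X1 : x1 \in <<[:: x0; x1; x2; x3]>>%VS by rewrite memv_span ?inE ?eqxx ?orbT.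
have X2 : x2 \in <<[:: x0; x1; x2; x3]>>%VS by rewrite memv_span ?inE ?eqxx ?orbT.
have X3 : x3 \in <<[:: x0; x1; x2; x3]>>%VS by rewrite memv_span ?inE ?eqxx ?orbT.
by do 5![case/predU1P => [->|]; rewrite ?memvD //]; move/eqP->; rewrite memvD.
Qed.

(** Decoding puts [x] in the span of the first [6 - r] symbols of the common descendant, which occur
    among the first six symbols of the word of [y]; the converse is symmetric. *)
Lemma clash_span (r i j : nat) (x y : seq V) h k :
  size x = 4%N -> size y = 4%N -> (r <= 2)%N -> (i + r <= 7)%N -> (j + r <= 7)%N ->
  del i r (wordV x h) = del j r (wordV y k) -> <<x>>%VS = <<y>>%VS.
Proof.
move=> szx szy r2 ir jr Euv; have r6 : (r <= 6)%N by apply: leq_trans r2 _.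
have sub x' y' i' j' h' k' : size x' = 4%N -> size y' = 4%N -> (i' + r <= 7)%N ->
    (j' + r <= 7)%N -> del i' r (wordV x' h') = del j' r (wordV y' k') ->
    (<<x'>> <= <<y'>>)%VS.
  move=> szx' szy' ir' jr' E'; apply/span_subvP => v.
  rewrite -(decode_wordK h' szx' r2 ir') E' => /decode_span.
  apply: subvP; apply/span_subvP => w /mem_take_del; rewrite subnK // => w_in.
  by apply: word_span (w_in _) => //; apply: leq_trans (leq_addr r j') _.
by apply/eqP; rewrite eqEsubv (sub _ _ _ _ _ _ szx szy ir jr Euv)
  (sub _ _ _ _ _ _ szy szx jr ir (esym Euv)).
Qed.

Lemma comb_memv s c : combV s c \in <<s>>%VS.
Proof.
elim: s c => [|v s IHs] c /=; first exact: mem0v.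
rewrite span_cons; case: ifP => _; last by apply: (subvP (addvSr _ _)).
by rewrite memv_add ?memv_line.
Qed.

Lemma F2_cases (a : 'F_2) : (a = 0) \/ (a = 1).
Proof. by case: a => [[|[|//]] ?]; [left | right]; apply/val_inj. Qed.

Lemma memv_comb s v : v \in <<s>>%VS -> exists2 c, c \in masks (size s) & combV s c = v.
Proof.
elim: s v => [|w s IHs] v.
  by rewrite span_nil memv0 => /eqP->; exists 0%num.
rewrite span_cons => /memv_addP[_ /vlineP[a ->]] [t /IHs[c c_s <-] ->].
have [->|->] := F2_cases a.
  exists (N.double c); first by apply/masksP; exists c; auto.
  by rewrite scale0r add0r /= N_odd_double N_div2_double.
exists (N.succ_double c); first by apply/masksP; exists c; auto.
by rewrite scale1r /= N_odd_succ_double N_div2_succ_double.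
Qed.

Lemma comb0 s : combV s 0%num = 0.
Proof. by elim: s => //= v s ->. Qed.

Lemma odd_lxor c e : N.odd (N.lxor c e) = N.odd c (+) N.odd e.
Proof. by rewrite -!N.bit0_odd N.lxor_spec; do 2!case: N.testbit. Qed.

Lemma div2_lxor c e : N.div2 (N.lxor c e) = N.lxor (N.div2 c) (N.div2 e).
Proof. by rewrite !N.div2_spec N.shiftr_lxor. Qed.

Lemma comb_lxor s : {morph combV s : c e / N.lxor c e >-> c + e}.
Proof.
elim: s => [|v s IHs] c e /=; first by rewrite addr0.
rewrite odd_lxor div2_lxor IHs.
case: (N.odd c); case: (N.odd e) => //=.
- by rewrite addrACA addvv_F2 add0r.
- by rewrite addrA.
- by rewrite addrCA.
Qed.

Lemma comb_eq0 s c : free s -> c \in masks (size s) -> combV s c = 0 -> c = 0%num.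
Proof.
elim: s c => [|v s IHs] c; first by rewrite inE => _ /eqP.
rewrite free_cons => /andP[v_s fr_s] /masksP[e e_s [] -> /=].
  by rewrite N_odd_double N_div2_double; move/(IHs _ fr_s e_s) => ->.
rewrite N_odd_succ_double N_div2_succ_double; move/eqP; rewrite addr_eq0 => /eqP v_e.
case/negP: v_s.
by rewrite v_e memvN comb_memv.
Qed.

Lemma comb_inj s : free s -> {in masks (size s) &, injective (combV s)}.
Proof.
move=> fr_s c e c_s e_s Ece; apply: N.lxor_eq; apply: (comb_eq0 fr_s).
  exact: masks_lxor.
by rewrite comb_lxor Ece addvv_F2.
Qed.

Lemma comb_rcons s w c : c \in masks (size s) -> combV (rcons s w) c = combV s c.
Proof.
elim: s c => [|v s IHs] c /=; first by rewrite inE => /eqP->.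
by case/masksP => e e_s [] ->; rewrite ?N_div2_double ?N_div2_succ_double IHs.
Qed.

Lemma comb_rcons_unit s w : combV (rcons s w) (unit_mask (size s)) = w.
Proof.
elim: s => [|v s IHs] /=; first by rewrite addr0.
by rewrite [unit_mask _]/= N_odd_double N_div2_double IHs.
Qed.

Variant digit_spec s v : N -> Prop :=
| DigitIn c of c \in masks (size s) & combV s c = v & v \in <<s>>%VS : digit_spec s v c
| DigitNew of v \notin <<s>>%VS : digit_spec s v (unit_mask (size s)).

Lemma digitP s v : digit_spec s v (digitV s v).
Proof.
rewrite /digit; set Q := fun c => combV s c == v.
have [has_c|/hasPn no_c] := boolP (has Q (masks (size s))).
  have /eqP Ec := nth_find (unit_mask (size s)) has_c.
  apply: DigitIn => //; last by rewrite -Ec comb_memv.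
  by rewrite mem_nth -?has_find.
rewrite nth_default; last by rewrite leqNgt -has_find; apply/hasPn.
by apply: DigitNew; apply/negP => /memv_comb[c /no_c/negP + /eqP].
Qed.

Lemma comb_digit s v w : (v \notin <<s>>%VS -> w = v) ->
  combV (rcons s w) (digitV s v) = v.
Proof.
case: digitP => [c c_s Ec _ _|v_s /(_ v_s)->]; last exact: comb_rcons_unit.
by rewrite comb_rcons.
Qed.

(** The marker of a new entry is not among the masks of length [size s]; the bound leaves four
    lengths to inspect. *)
Lemma digit_pivot s v : (size s < 4)%N ->
  (digitV s v == unit_mask (size s)) = (v \notin <<s>>%VS).
Proof.
move=> s4; case: digitP => [c c_s _ ->|->]; last by rewrite eqxx.
apply/negbTE; apply: contraL c_s => /eqP->.
by case: (size s) s4 => [|[|[|[|]]]].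
Qed.

Definition new_entries s : bitseq :=
  [seq nth 0 s i \notin <<take i s>>%VS | i <- iota 0 (size s)].

Lemma new_entries_rcons s v :
  new_entries (rcons s v) = rcons (new_entries s) (v \notin <<s>>%VS).
Proof.
rewrite /new_entries size_rcons -[(size s).+1]addn1 iotaD map_cat /= cats1 add0n.
rewrite nth_rcons ltnn eqxx -[in take _ _]cats1 take_size_cat //; congr rcons.
apply/eq_in_map => i; rewrite mem_iota => /= i_s.
by rewrite nth_rcons i_s -cats1 takel_cat // ltnW.
Qed.

Lemma new_entries_basis s : basis_of <<s>>%VS (mask (new_entries s) s).
Proof.
elim/last_ind: s => [|s v IHs]; first by rewrite /basis_of nil_free eqxx.
rewrite new_entries_rcons -[rcons _ (_ \notin _)]cats1 -[in mask _ _]cats1.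
rewrite mask_cat; last by rewrite size_map size_iota.
have [/eqP sp fr] := andP IHs.
case: (boolP (v \in _)) => v_s /=.
  rewrite cats0 /basis_of fr andbT -cats1 span_cat span_seq1 sp.
  by apply/eqP/esym/addv_idPl.
rewrite /basis_of -cats1 !span_cat sp eqxx /=.
rewrite (perm_free (_ : perm_eq _ (v :: mask (new_entries s) s))); last first.
  by rewrite cats1 perm_rcons.
by rewrite free_cons sp v_s.
Qed.

Lemma pivotsE x : size x = 4%N -> pivotsV x = new_entries x.
Proof.
move=> szx; rewrite /new_entries szx; apply/eq_in_map => i.
rewrite mem_iota => /= i4.
rewrite (nth_map 0%N) ?size_iota // nth_iota //.
have sz : size (take i x) = i by rewrite size_takel // szx ltnW.
by rewrite -[in unit_mask i]sz digit_pivot ?sz.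
Qed.

End F2Vectors.

(** * Positions in a frame *)

Section Frame.
Variables (V : eqType) (z : V).
Implicit Types (ps : bitseq) (x ext : seq V).

Lemma size_frame ps x ext : size (frame z ps x ext) = size ps.
Proof. by elim: ps x ext => //= -[] ps IHps x ext /=; rewrite IHps. Qed.

Lemma nth_frame ps x ext i : nth false ps i -> nth z (frame z ps x ext) i = nth z x i.
Proof.
elim: ps x ext i => [|b ps IHps] x ext [|i] //=.
  by move->; rewrite nth0.
by move=> /IHps E; case: b => /=; rewrite E nth_behead.
Qed.

Lemma mask_frame ps x ext : size x = size ps -> mask ps (frame z ps x ext) = mask ps x.
Proof.
elim: ps x ext => [|b ps IHps] [|v x] ext //= [/IHps E].
by case: b => /=; rewrite E.
Qed.

Lemma mask_negb_frame ps x ext : size ext = count negb ps ->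
  mask (map negb ps) (frame z ps x ext) = ext.
Proof.
elim: ps x ext => [|b ps IHps] x ext /=; first by move/size0nil.
case: b => /=; first exact: IHps.
by case: ext => //= v ext [/IHps->].
Qed.
End Frame.

Lemma nibbles_lxor (c e : N) :
  c \in nibbles -> e \in nibbles -> N.lxor c e \in nibbles.
Proof. exact: masks_lxor. Qed.

Lemma nibbles0 : 0%num \in nibbles. Proof. by []. Qed.

(** * Separation in dimension four *)

Section Separation.
Variable V : vectType 'F_2.
Hypothesis dimV : \dim {:V} = 4%N.
(** For nonzero [a], [psi a] is an additive form with value one at [a]. Its choice depends on [a]
    alone, so words with the same axis share their form. *)
Variable psi : V -> V -> bool.
Hypothesis psiD : forall a, {morph psi a : v w / v + w >-> v (+) w}.
Hypothesis psi0l : forall v, psi 0 v = false.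
Hypothesis psi0r : forall a, psi a 0 = false.
Hypothesis psi_diag : forall a, psi a a = (a != 0).

Local Notation wordV := (word (0 : V) +%R).
Local Notation decodeV := (decode (0 : V) +%R).
Local Notation combV := (comb (0 : V) +%R).
Local Notation digitsV := (digits (0 : V) +%R).
Local Notation pivotsV := (pivots (0 : V) +%R).
Local Notation axisV := (axis (0 : V) +%R).
Local Notation hueV := (hue (0 : V) +%R).

(** Depends only on the span of [x], hence is shared by words with a common descendant. *)
Definition completion (x : seq V) : seq V := vbasis (<<x>>^C)%VS.

Definition frame_of (x : seq V) : seq V := frame 0 (pivotsV x) x (completion x).

Definition span_hue (x : seq V) : V := hueV x (completion x) (psi (axisV x)).

Section Coordinates.
Variable x : seq V.
Hypothesis size_x : size x = 4%N.

Let f : N -> V := combV (frame_of x).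
Let xN : seq N := rebuild (digitsV x).
Let bits : bitseq := map (psi (axisV x)) (frame_of x).

Lemma size_completion : size (completion x) = count negb (pivotsV x).
Proof.
have /andP[/eqP sp /eqP dim_sel] := new_entries_basis x.
rewrite size_tuple dimv_compl dimV -sp dim_sel.
rewrite size_mask ?size_map ?size_iota // -pivotsE //.
have sz_p : size (pivotsV x) = 4%N by rewrite size_map size_iota.
by rewrite -[X in (X - _)%N]sz_p -(count_predC id (pivotsV x)) addKn; apply: eq_count.
Qed.

Lemma size_frame_of : size (frame_of x) = 4%N.
Proof. by rewrite size_frame size_map size_iota. Qed.

(** The four vectors include a basis of the span of [x] and one of a complement, so they span the
    whole space. *)
Lemma free_frame : free (frame_of x).
Proof.
have sz_ps : size x = size (pivotsV x) by rewrite size_x size_map size_iota.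
suff full : (fullv <= <<frame_of x>>)%VS.
  rewrite /free size_frame_of eqn_leq -{1}size_frame_of dim_span -dimV.
  exact: dimvS.
rewrite -(addv_complf <<x>>%VS) subv_add; apply/andP; split.
  rewrite -(span_basis (new_entries_basis x)) -pivotsE //.
  by rewrite -(mask_frame 0 (completion x) sz_ps); apply: sub_span => v /mem_mask.
rewrite -(span_basis (vbasisP (<<x>>^C)%VS)) -/(completion x).
rewrite -{1}(mask_negb_frame 0 x size_completion).
by apply: sub_span => v /mem_mask.
Qed.

Lemma frame_comb_lxor : {morph f : c e / N.lxor c e >-> c + e}.
Proof. exact: comb_lxor. Qed.

Lemma frame_comb0 : f 0%num = 0.
Proof. exact: comb0. Qed.

Lemma frame_comb_inj : {in nibbles &, injective f}.
Proof. by have := comb_inj free_frame; rewrite size_frame_of. Qed.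

Lemma frame_comb_unit (i : nat) : (i < 4)%N -> f (unit_mask i) = nth 0 (frame_of x) i.
Proof.
rewrite /f; case: (frame_of x) size_frame_of => [|b0 [|b1 [|b2 [|b3 []]]]] // _.
by case: i => [|[|[|[|]]]] //= _; rewrite ?addr0.
Qed.

(** Induction on prefixes: a digit either combines entries already recovered or is the marker, which
    [f] sends to the frame vector at that index, namely the new entry. *)
Lemma rebuild_digits : map f xN = x.
Proof.
suff E k : (k <= 4)%N -> map f (rebuild (take k (digitsV x))) = take k x.
  by have:= E 4%N isT; rewrite !take_oversize ?size_x ?size_map ?size_iota.
elim: k => [|k IHk] k4; first by rewrite !take0.
have sz_d : size (digitsV x) = 4%N by rewrite size_map size_iota.
rewrite !(take_nth 0) ?size_x // (take_nth 0%num) ?sz_d //.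
rewrite /rebuild -cats1 foldl_cat /= -/(rebuild _).
set s := rebuild _ in IHk *; have Es := IHk (ltnW k4).
have sz_s : size s = k by rewrite -(size_map f) Es size_takel // size_x ltnW.
rewrite map_rcons; congr rcons => //.
rewrite (comb_transfer frame_comb0 frame_comb_lxor) map_rcons Es sz_s.
rewrite (nth_map 0%N) ?size_iota // nth_iota //.
apply: comb_digit => v_new; rewrite frame_comb_unit //; apply: nth_frame.
by rewrite pivotsE // /new_entries size_x (nth_map 0%N) ?size_iota ?nth_iota.
Qed.

Lemma rebuild_nibbles : all (mem nibbles) xN.
Proof.
have: (size (digitsV x) <= 4)%N by rewrite size_map size_iota.
rewrite /xN; elim/last_ind: (digitsV x) => [|d c IHd] //; rewrite size_rcons => d4.
rewrite /rebuild -cats1 foldl_cat /= -/(rebuild _); have Pd := IHd (ltnW d4).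
rewrite all_rcons Pd andbT; apply: comb_closed => //; first exact: nibbles_lxor.
have sz_r (s : seq N) : size (rebuild s) = size s.
  elim/last_ind: s => // s e IHs.
  by rewrite /rebuild -cats1 foldl_cat /= size_rcons -/(rebuild s) IHs size_cat addn1.
by rewrite all_rcons Pd andbT sz_r; case: (size d) d4 => [|[|[|[|]]]].
Qed.

Lemma frame_comb_units : map f units = frame_of x.
Proof.
apply: (@eq_from_nth _ 0) => [|i]; first by rewrite size_frame_of.
rewrite size_map size_map size_iota => i4.
by rewrite -map_comp (nth_map 0%N) ?size_iota // nth_iota // -frame_comb_unit.
Qed.

Lemma digits_rebuild : digitsN xN = digitsV x.
Proof.
rewrite -[in RHS]rebuild_digits.
rewrite (digits_transfer frame_comb0 frame_comb_lxor nibbles0 nibbles_lxor frame_comb_inj) //.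
exact: rebuild_nibbles.
Qed.

Lemma axis_rebuild : axisV x = f (axisN xN).
Proof.
rewrite -[in LHS]rebuild_digits.
by rewrite (axis_transfer frame_comb0 frame_comb_lxor nibbles0 nibbles_lxor frame_comb_inj rebuild_nibbles).
Qed.

Lemma axis_nibble : axisN xN \in nibbles.
Proof. exact: (axis_closed nibbles0 nibbles_lxor rebuild_nibbles). Qed.

Lemma cobasis_rebuild : map f (cobasis xN) = completion x.
Proof.
rewrite /cobasis map_mask frame_comb_units.
have -> : pivotsN xN = pivotsV x by rewrite /pivots digits_rebuild.
exact: mask_negb_frame size_completion.
Qed.

Lemma cobasis_nibbles : all (mem nibbles) (cobasis xN).
Proof. by apply/allP => c /mem_mask; apply: (allP (erefl : all (mem nibbles) units)). Qed.

Lemma psi_frame_comb a : psi a \o f =1 parity (map (psi a) (frame_of x)).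
Proof. by move=> c; rewrite -(comb_transfer (psi0r a) (psiD a)). Qed.

Lemma admissible_rebuild : admissible xN bits.
Proof.
rewrite /admissible /bits axis_rebuild; case: eqP => [->|/eqP a0].
  rewrite frame_comb0 (eq_map psi0l); apply/eqP; rewrite -size_frame_of.
  by elim: (frame_of x) => //= v s ->.
rewrite -psi_frame_comb /= psi_diag -frame_comb0; apply: contra a0 => /eqP.
by move=> E; rewrite (frame_comb_inj _ _ E) ?axis_nibble.
Qed.

Lemma digits_choices :
  digitsV x \in choices [seq rcons (masks i) (unit_mask i) | i <- iota 0 4].
Proof.
apply: mem_choices.
have: all (fun i => (i < 4)%N) (iota 0 4) by [].
rewrite /digits; elim: (iota 0 4) => //= i s IHs /andP[i4 /IHs ->]; rewrite andbT.
have sz_t : size (take i x) = i by rewrite size_takel // size_x ltnW.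
rewrite mem_rcons inE; case: digitP => [c|_]; rewrite sz_t ?eqxx //.
by move=> ->; rewrite orbT.
Qed.

(** The two filters of the exhaustive check are passed by [digits_rebuild] and
    [admissible_rebuild]. *)
Lemma separated_rebuild (r i j : nat) : (0 < r <= 2)%N ->
  (i + r <= 7)%N -> (j + r <= 7)%N -> separated xN bits r i j.
Proof.
move=> r12 ir jr; have lt8 k : (k + r <= 7)%N -> k \in iota 0 (8 - r).
  by move=> kr; rewrite mem_iota /= add0n ltn_subRL addnC ltnS.
have bits_in : bits \in choices (nseq 4 [:: false; true]).
  apply: mem_choices; rewrite -[4%N]size_frame_of /bits.
  by elim: (frame_of x) => //= v s ->; rewrite andbT !inE; case: psi.
have /allP/(_ _ digits_choices) := all_separatedE.
cbv beta zeta; rewrite -/xN digits_rebuild eqxx.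
move=> /allP/(_ _ bits_in); rewrite admissible_rebuild => /allP/(_ r).
have -> : r \in [:: 1; 2]%N by case: (r) r12 => [|[|[|]]].
by move=> /(_ isT)/allP/(_ _ (lt8 _ ir))/allP/(_ _ (lt8 _ jr)).
Qed.

(** Stated for every tuple of nibbles because the competing word is also read in the frame of
    [x]. *)
Lemma hue_rebuild (yN : seq N) : all (mem nibbles) yN ->
  hueV (map f yN) (completion x) (psi (axisV x)) = f (hueN yN (cobasis xN) (parity bits)).
Proof.
move=> yN_n; rewrite -cobasis_rebuild.
apply: (hue_transfer frame_comb0 frame_comb_lxor nibbles0 nibbles_lxor frame_comb_inj) => // c.
exact: psi_frame_comb.
Qed.

End Coordinates.

Lemma span_hue_separates (r i j : nat) (x y : seq V) :
  size x = 4%N -> size y = 4%N -> (r <= 2)%N -> (i + r <= 7)%N -> (j + r <= 7)%N ->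
  del i r (wordV x (span_hue x)) = del j r (wordV y (span_hue y)) -> x = y.
Proof.
move=> szx szy r2 ir jr Exy.
have Dx := decode_wordK (span_hue x) szx r2 ir.
have Dy := decode_wordK (span_hue y) szy r2 jr.
have [r0|r_gt0] := posnP r.
  by move: Exy; rewrite r0 /del !addn0 !cat_take_drop; apply: word_inj.
have spxy := clash_span szx szy r2 ir jr Exy.
have exty : completion y = completion x by rewrite /completion spxy.
set f := combV (frame_of x); set xN := rebuild (digitsV x).
set p := map (psi (axisV x)) (frame_of x).
have f_eq := map_transfer_inj (frame_comb_inj szx).
have f0x : f 0%num = 0 by apply: frame_comb0.
have fD : {morph f : c e / N.lxor c e >-> c + e} by apply: frame_comb_lxor.
have xN_n : all (mem nibbles) xN by apply: rebuild_nibbles.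
have ext_n := cobasis_nibbles x.
pose hN c := hueN c (cobasis xN) (parity p).
have hN_n c : all (mem nibbles) c -> hN c \in nibbles.
  by move=> c_n; apply: (hue_closed nibbles0 nibbles_lxor).
pose uN := del i r (wordN xN (hN xN)).
have uN_n : all (mem nibbles) uN.
  apply/all_del/(word_closed nibbles0 nibbles_lxor); first exact: xN_n.
  exact: hN_n.
have f_hN c : all (mem nibbles) c ->
    f (hN c) = hueV (map f c) (completion x) (psi (axisV x)).
  by move=> c_n; rewrite (hue_rebuild szx c_n).
have fuN : map f uN = del i r (wordV x (span_hue x)).
  rewrite map_del (word_transfer f0x fD) (rebuild_digits szx).
  by rewrite (f_hN _ xN_n) (rebuild_digits szx).
(* The competitor is forced: decoding the common descendant yields [y] in the coordinates of [x]. *)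
pose yN := decodeN r j uN.
have yN_n : all (mem nibbles) yN by apply: (decode_closed nibbles0 nibbles_lxor).
have fyN : map f yN = y by rewrite (decode_transfer f0x fD) fuN Exy.
have r12 : (0 < r <= 2)%N by rewrite r_gt0.
have := separated_rebuild szx r12 ir jr.
rewrite /separated -/p -/xN -/(hN xN) -/uN -/yN.
case: eqP => [yx _|_].
  by rewrite -fyN yx (rebuild_digits szx).
have take_n s : all (mem nibbles) s -> all (mem nibbles) (take (6 - r) s).
  by move=> /allP s_n; apply/allP => c /mem_take /s_n.
(* A genuine competitor cannot be dismissed by a mismatch before the last symbol. *)
have -> : take (6 - r) (del j r (wordN yN 0%num)) = take (6 - r) uN.
  apply: f_eq; [apply/take_n/all_del | exact: take_n uN_n |].
    by apply: (word_closed nibbles0 nibbles_lxor yN_n); apply: nibbles0.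
  rewrite !map_take fuN Exy map_del (word_transfer f0x fD) fyN.
  exact: take_del_word.
(* For [y] other than [x] the check demands equal axes. Both hues then use the same form, so the
   computed hue is that of [y], and the inequality of descendants contradicts [Exy]. *)
have axy_of : axisN yN = axisN xN -> axisV y = axisV x.
  move=> axyN; rewrite -fyN.
  rewrite (axis_transfer f0x fD nibbles0 nibbles_lxor (frame_comb_inj szx) yN_n) axyN.
  by rewrite [RHS](axis_rebuild szx).
rewrite eqxx; case: eqP => [/axy_of axy|_ //] /eqP[]; apply: f_eq; last 1 first.
- rewrite fuN Exy map_del (word_transfer f0x fD) fyN (f_hN _ yN_n) fyN.
  rewrite /span_hue exty axy; reflexivity.
- apply/all_del/(word_closed nibbles0 nibbles_lxor yN_n); exact: hN_n.
- exact: uN_n.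
Qed.

End Separation.

(** * Correction as injectivity on descendants *)

(** The one-based burst position [d] becomes the zero-based [d.-1], and a codeword determines [x] by
    its first four symbols. *)
Lemma corrects_WcodeP (F : finNzRingType) (H : 4.-tuple F -> F) :
  corrects_short_bursts (Wcode H) <->
  forall (r i j : nat) (x y : 4.-tuple F),
    (r <= 2)%N -> (i + r <= 7)%N -> (j + r <= 7)%N ->
    del i r (word 0 +%R x (H x)) = del j r (word 0 +%R y (H y)) -> x = y.
Proof.
split=> [corr r i j x y r2 ir jr Exy | sep r r2 z w zC wC zw u []].
  apply/eqP; apply: contraT => xy.
  pose c (t : 4.-tuple F) : 7.-tuple F := [tuple of rcons (Wword t) (H t)].
  have cC t : c t \in Wcode H by apply: imset_f.
  case: (corr r r2 (c x) (c y) (cC x) (cC y) _ (del i r (c x))).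
    apply: contraNneq xy => /(congr1 (take 4 \o val)) /=.
    case: x y {Exy} => [[|? [|? [|? [|? []]]]] //= ?] [[|? [|? [|? [|? []]]]] //= ?].
    by move=> E; apply/eqP/val_inj.
  have desc k t : (k + r <= 7)%N -> burst_descendant r (c t) (del k r (c t)).
    by move=> kr; exists k.+1; split; rewrite ?size_tuple // addSn addn1 ltnS.
  by split; [apply: desc | rewrite [del i r _]Exy; apply: desc].
case/imsetP: zC zw => x _ ->; case/imsetP: wC => y _ -> xy.
have bound d : (0 < d)%N -> (d + r <= 7 + 1)%N -> (d.-1 + r <= 7)%N.
  by case: d => // d _; rewrite addSn addn1 ltnS.
case=> d [d0 dr ->] [e [e0 er Exy]].
by case/eqP: xy; rewrite (sep r d.-1 e.-1 x y r2 (bound d d0 dr) (bound e e0 er) Exy).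
Qed.

Lemma del_word (V : eqType) (z : V) (add : V -> V -> V) (r i : nat) (x : seq V)
    (h : V) : (i + r <= 6)%N ->
  del i r (word z add x h) = rcons (del i r (take 6 (word z add x z))) h.
Proof.
move=> ir; have -> : word z add x h = rcons (take 6 (word z add x z)) h by [].
have sz : size (take 6 (word z add x z)) = 6%N by [].
rewrite /del -cats1 takel_cat ?sz ?(leq_trans (leq_addr r i)) //.
by rewrite drop_cat sz; case: ltngtP ir => // [_|->] _;
  rewrite -cats1 -catA // [in RHS]drop_oversize ?sz.
Qed.

(** * Lower bound *)

(** Both bursts stay within the first six symbols, so equal last symbols would complete the
    clash. *)
Definition collide (x y : seq N) : bool :=
  has (fun r => has (fun i => has (fun j =>
      del i r (take 6 (wordN x 0%num)) == del j r (take 6 (wordN y 0%num)))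
    (iota 0 (7 - r))) (iota 0 (7 - r))) [:: 1; 2]%N.

(** The burst on [x] erases its last two symbols, hence also its value under [H]. The burst on [y]
    stops before [v], so the value [v] at [y] clashes with [x] whatever [H] does there. *)
Definition forbids (y : 4.-tuple N) (v : N) : bool :=
  has (fun i =>
    let u := del i 2 (wordN y v) in
    let x := [tuple nth 0%num u 0; nth 0%num u 1; nth 0%num u 2; nth 0%num u 3] in
    [&& x != y, all (mem (masks 2)) x & del 5 2 (wordN x 0%num) == u]) (iota 0 5).

(* The entries are masks over the pair formed by 1 and [base_point].          *)
Definition clique : seq (4.-tuple N) :=
  [:: [tuple 3; 2; 1; 3]; [tuple 3; 3; 2; 2]; [tuple 3; 2; 2; 3];
      [tuple 3; 2; 2; 1]; [tuple 3; 3; 1; 2]; [tuple 1; 3; 3; 2]]%num.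

Lemma clique_collide :
  allrel (fun x y : 4.-tuple N => (x == y) || collide x y) clique clique.
Proof. by vm_compute. Qed.

Lemma clique_forbids :
  allrel forbids clique [:: 1; 2; 3]%num.
Proof. by vm_compute. Qed.

Section LowerBound.
Variables (m : nat) (m_gt0 : (0 < m)%N).
Local Notation F := (GF2m m_gt0).
Variable H : 4.-tuple F -> F.
Hypothesis corr : corrects_short_bursts (Wcode H).

Let sep := (corrects_WcodeP H).1 corr.

Definition base_point : F := H [tuple 0; 0; 1; 0].

Lemma base_point_free : free [:: 1; base_point].
Proof.
have oo : 1 + 1 = 0 :> F by apply: addvv_F2.
have b0 : base_point != 0.
  (* With last symbol 0 both words shrink to 1, 0, 1, 0, 0; the second burst erases the unknown
     value of [H]. *)
  apply/eqP => b0; have := @sep 2 0 5 [tuple 0; 0; 1; 0] [tuple 1; 0; 1; 0].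
  rewrite -/base_point b0 /del /= oo add0r addr0.
  move=> /(_ isT isT isT erefl) /(congr1 val) [] /eqP.
  by rewrite eq_sym oner_eq0.
have b1 : base_point != 1.
  (* With last symbol 1 both words shrink to 0, 0, 0, 1, 0, 1, again without the unknown value. *)
  apply/eqP => b1; have := @sep 1 2 6 [tuple 0; 0; 1; 0] [tuple 0; 0; 0; 1].
  rewrite -/base_point b1 /del /= add0r addr0.
  move=> /(_ isT isT isT erefl) /(congr1 val) [] /eqP.
  by rewrite oner_eq0.
rewrite free_cons span_seq1 seq1_free b0 andbT.
apply/vlineP => -[a Ea]; have [a0|a1] := F2_cases a.
  by move/eqP: Ea; rewrite a0 scale0r oner_eq0.
by move/eqP: b1; rewrite Ea a1 scale1r.
Qed.

Let f : N -> F := comb 0 +%R [:: 1; base_point].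

Lemma plane_inj : {in masks 2 &, injective f}.
Proof. exact: comb_inj base_point_free. Qed.

Let f0 : f 0%num = 0. Proof. exact: comb0. Qed.

Let fD : {morph f : c e / N.lxor c e >-> c + e}. Proof. exact: comb_lxor. Qed.

Lemma map_plane_inj (x y : 4.-tuple N) : all (mem (masks 2)) x -> all (mem (masks 2)) y ->
  map_tuple f x = map_tuple f y -> x = y.
Proof.
move=> x2 y2 /(congr1 val) Exy; apply/val_inj.
exact: (map_transfer_inj plane_inj) Exy.
Qed.

Lemma collide_hue (x y : 4.-tuple N) : all (mem (masks 2)) x -> all (mem (masks 2)) y ->
  collide x y -> H (map_tuple f x) = H (map_tuple f y) -> x = y.
Proof.
move=> x2 y2 /hasP[r r12 /hasP[i i_r /hasP[j j_r /eqP Exy]]] Hxy.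
have r2 : (r <= 2)%N by move: r12; rewrite !inE => /orP[] /eqP->.
have bound k : k \in iota 0 (7 - r) -> (k + r <= 6)%N.
  by rewrite mem_iota /= add0n ltn_subRL addnC ltnS.
apply: map_plane_inj => //; have [ir jr] := (bound i i_r, bound j j_r).
apply: (sep (r := r) (i := i) (j := j)); rewrite ?(leq_trans ir) ?(leq_trans jr) //.
rewrite !del_word // Hxy; congr rcons.
have E s : map f (take 6 (wordN s 0%num)) = take 6 (word 0 +%R (map f s) 0).
  by rewrite map_take (word_transfer f0 fD) f0.
by rewrite -!E -!map_del Exy.
Qed.

Lemma forbids_hue (y : 4.-tuple N) (v : N) : all (mem (masks 2)) y ->
  forbids y v -> H (map_tuple f y) <> f v.
Proof.
move=> y2 /hasP[i]; rewrite mem_iota => /= i5; set x := [tuple _; _; _; _].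
case/and3P => /eqP xy x2 /eqP Exy Hy; apply: xy; apply: map_plane_inj => //.
apply: (sep (r := 2) (i := 5) (j := i)) => //.
  exact: leq_add (ltnW i5) (leqnn 2).
rewrite Hy -(word_transfer f0 fD) -map_del -Exy map_del (word_transfer f0 fD).
reflexivity.
Qed.

Lemma card_lower_bound : (9 <= 2 ^ m)%N.
Proof.
rewrite -(card_GF2m m_gt0).
pose s := map f [:: 1; 2; 3]%num ++ [seq H (map_tuple f x) | x <- clique].
have cl2 x : x \in clique -> all (mem (masks 2)) x.
  by apply/allP: x.
suff /card_uniqP s9 : uniq s by rewrite -[9%N]/(size s) -s9 max_card.
rewrite cat_uniq; apply/and3P; split.
- rewrite map_inj_in_uniq //; apply: sub_in2 plane_inj.
  exact/allP.
- apply/hasPn => _ /mapP[y y_cl ->]; apply/mapP => -[v v3 Hy].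
  have /allrelP/(_ _ _ y_cl v3) fb := clique_forbids.
  exact: forbids_hue (cl2 _ y_cl) fb Hy.
rewrite map_inj_in_uniq // => x y x_cl y_cl.
have /allrelP/(_ _ _ x_cl y_cl)/orP[/eqP->//|col] := clique_collide.
exact: collide_hue (cl2 _ x_cl) (cl2 _ y_cl) col.
Qed.

End LowerBound.

(** * Span transport *)

Section Transport.

(** The coordinate form at an index where [a] is nonzero, chosen from [a] alone; it serves as
    [psi]. *)
Definition lead (n : nat) (a v : 'rV['F_2]_n) : bool :=
  if [pick i | a 0 i != 0] is Some i then v 0 i != 0 else false.

Lemma leadD n (a : 'rV['F_2]_n) : {morph lead a : v w / v + w >-> v (+) w}.
Proof.
move=> v w; rewrite /lead; case: pickP => // i _; rewrite mxE.
by case: (F2_cases (v 0 i)) => ->; case: (F2_cases (w 0 i)) => ->.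
Qed.

Lemma lead0l n (v : 'rV['F_2]_n) : lead 0 v = false.
Proof. by rewrite /lead; case: pickP => // i; rewrite mxE eqxx. Qed.

Lemma lead0r n (a : 'rV['F_2]_n) : lead a 0 = false.
Proof. by rewrite /lead; case: pickP => // i _; rewrite mxE eqxx. Qed.

Lemma lead_diag n (a : 'rV['F_2]_n) : lead a a = (a != 0).
Proof.
rewrite /lead; case: pickP => [i a_i|a0].
  by have [a0|_ //] := eqVneq a 0; rewrite a0 mxE eqxx in a_i.
apply/esym/negbTE; rewrite negbK; apply/eqP/rowP => i.
by rewrite mxE; apply/eqP/negbFE/a0.
Qed.

Definition hstar (x : 4.-tuple 'rV['F_2]_4) : 'rV['F_2]_4 := span_hue (@lead 4) x.

Variables (m : nat) (m_gt0 : (0 < m)%N).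
Hypothesis m_ge4 : (4 <= m)%N.
Local Notation F := (GF2m m_gt0).

Lemma theta_lin (x : 4.-tuple F) : {morph theta x : u v / u + v >-> u + v}.
Proof. by move=> u v; apply/rowP => i; rewrite !mxE linearD. Qed.

Lemma theta0 (x : 4.-tuple F) : theta x 0 = 0.
Proof. by apply/rowP => i; rewrite !mxE linear0. Qed.

Lemma transport_corrects :
  corrects_short_bursts (Wcode (fun x : 4.-tuple F => span_transport hstar x)).
Proof.
apply/corrects_WcodeP => r i j x y r2 ir jr Exy.
have spxy : <<x>>%VS = <<y>>%VS.
  exact: clash_span (size_tuple x) (size_tuple y) r2 ir jr Exy.
(* The transport list is computed from the span alone, which a common descendant determines. *)
have theta_xy : theta y = theta x.
  by rewrite /theta /transport_basis /transport_list spxy.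
have in_list (t : 4.-tuple F) : {subset t <= <<transport_list t>>%VS}.
  move=> v v_t; have [_ _ /subvP sub] := transport_list_free t m_ge4.
  by apply/sub/memv_span.
(* Transport carries the codeword of [t] to the codeword of its image under [hstar], moving the
   clash to dimension four. *)
have wordE (t : 4.-tuple F) :
    map (theta t) (word 0 +%R t (span_transport hstar t)) =
    word 0 +%R (map (theta t) t) (span_hue (@lead 4) (map (theta t) t)).
  by rewrite (word_transfer (theta0 t) (theta_lin t)) theta_invK.
have Emap : map (theta x) x = map (theta x) y.
  apply: (@span_hue_separates _ _ (@lead 4) (@leadD 4) (@lead0l 4) (@lead0r 4)
    (@lead_diag 4) r i j); rewrite ?size_map ?size_tuple //.
    by rewrite dimvf /dim /= mul1n.
  by rewrite -wordE -theta_xy -wordE theta_xy -!map_del Exy.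
have listK (t : 4.-tuple F) : map (theta_inv t) (map (theta t) t) = t.
  rewrite -map_comp; apply: map_id_in => v v_t /=.
  by rewrite thetaK // in_list.
apply/val_inj; rewrite /= -(listK x) Emap.
have -> : theta_inv x = theta_inv y.
  by rewrite /theta_inv /transport_basis /transport_list spxy.
by rewrite -theta_xy listK.
Qed.

End Transport.

(** * The threshold sixteen and the universal function *)

Theorem theorem9p1 :
  (forall (m : nat) (m_gt0 : (1 <= m)%N),
     (exists H : 4.-tuple (GF2m m_gt0) -> GF2m m_gt0,
        corrects_short_bursts (Wcode H))
     <-> (16 <= 2 ^ m)%N)
  /\
  (exists hstar : 4.-tuple 'rV['F_2]_4 -> 'rV['F_2]_4,
     forall (m : nat) (m_gt0 : (1 <= m)%N), (4 <= m)%N ->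
       corrects_short_bursts
         (Wcode (fun x : 4.-tuple (GF2m m_gt0) => span_transport hstar x))).
Proof.
split; last by exists hstar => m m_gt0 m_ge4; apply: transport_corrects.
move=> m m_gt0; split=> [[H corrH]|q_ge16].
  have := card_lower_bound corrH.
  (* Nine elements exclude [m] up to 3, and the next power of two is sixteen. *)
  case: m m_gt0 {H corrH} => [|[|[|[|m]]]] // _ _.
  by rewrite (leq_pexp2l (m := 2) (n1 := 4)).
exists (@span_transport hstar m m_gt0); apply: transport_corrects.
by rewrite -(leq_exp2l (m := 2)).
Qed.
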